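(* Let $V^1,V^2,V^3,U,W,H$ be irreducible finite-dimensional representations of $\mathfrak{gl}_n$ with non-negative integer highest weights whose last coordinate is $0$, and let $f_1,f_2,f_3,f_4$ be semi-invariants of product form (see context) of types $(V^1,V^2,U)$, $(U,V^3,W)$, $(V^2,V^3,H)$, $(V^1,H,W)$ respectively. Then the $6j$-symbol $$\begin{Bmatrix} V^1 & V^2 & U\\ V^3 & W & H\end{Bmatrix}^{f_1,f_2}_{f_3,f_4}=f_1\Big(\tfrac{\partial}{\partial A^1},\tfrac{\partial}{\partial A^2},A^4\Big)f_2\Big(\tfrac{\partial}{\partial A^4},\tfrac{\partial}{\partial A^3},A^5\Big)f_3\Big(A^2,A^3,\tfrac{\partial}{\partial A^6}\Big)f_4\Big(A^1,A^6,\tfrac{\partial}{\partial A^5}\Big)\Big|_{A^1=\dots=A^6=0}$$ equals $\mathcal{J}_\gamma(z;L)$, the value of the hypergeometric type finite sum $$\mathcal{J}_\gamma(\mathcal{Z};L)=\sum_{x\in\mathcal{H}\cap pr^{-1}(D)}\frac{\Gamma(pr(x)+1)\,\mathcal{Z}^x}{\Gamma(x+1)}$$ obtained by substituting for each variable $Z^i_{\alpha}$ of the collection $\mathcal{Z}=\{Z^1,Z^2,Z^3,Z^4\}$ the corresponding number $z^i_{\alpha}$.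
   Context: Semi-invariants of product form. Let $a_i^j,b_i^j,c_i^j$ ($1\le i,j\le n$) be three independent sets of matrix elements, and $a_{i_1,\dots,i_k}=\det(a_i^j)_{i=i_1,\dots,i_k}^{j=1,\dots,k}$, similarly for $b,c$. The representation with highest weight $[m_1,\dots,m_n]$, $m_{n+1}=0$, is realized as the space of polynomials in the determinants $a_X$ of degree $m_k-m_{k+1}$ in determinants of size $k$; $\mathfrak{gl}_n$ acts by derivations on lower indices ($E_{i,j}$ replaces $j$ by $i$). A triple tensor product is realized in polynomials in $a,b,c$. A semi-invariant is an eigenvector of all $E_{i,i}$ annihilated by all $E_{i,j}$, $i\ne j$. A building block $((x^{j_1}\cdots x^{j_n})\cdots(y^{i_1}\cdots y^{i_n}))$, where each letter $x,\dots,y$ is one of $a,b,c$ (possibly different for different letters), is obtained as follows. The multiplicities of the upper indices $1,2,\dots,n$ among the letters $a$ form a partition, and similarly for $b$ and for $c$. In each bracket the lower indices of the $n$ letters are given the values $1,\dots,n$ and antisymmetrized (sum over all permutations with signs). Then the three Young symmetrizers are overlaid onto the upper indices: for the letters $a$, they are placed into the boxes of the Young diagram of the partition, letters with upper index $k$ being in row $k$, and the upper indices are first antisymmetrized over columns and then symmetrized over rows, and the same is done for $b$ and $c$. Each building block can be written as a polynomial in determinants $\sum_\alpha z_\alpha a^{p_\alpha}b^{q_\alpha}c^{r_\alpha}$ (multi-index notation, $a^{p_\alpha}=\prod_X a_X^{p_{\alpha,X}}$, $z_\alpha$ numeric coefficients); such an expression is fixed for each building block. A semi-invariant of product form is $f=\prod\frac{1}{t!}\big(((x^{j_1}\cdots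 x^{j_n})\cdots(y^{i_1}\cdots y^{i_n}))\big)^t$, a finite product over distinct building blocks with non-negative integer exponents $t$ depending on the block. It has type $(V,W,U)$, with highest weights $[m_k],[M_k],[m'_k]$, if in the set of all its upper indices the index $k$ occurs $m_k$ times on $a$, $M_k$ times on $b$, $m'_k$ times on $c$, for every $k$. Variables $A$ and the $6j$-symbol. $A^j_X$, $j=1,\dots,6$, are six independent sets of variables indexed by nonempty proper subsets $X\subset\{1,\dots,n\}$, antisymmetric in $X$ and satisfying no other relations. The polynomial $f(A,B,C)$ is obtained from the fixed expression of $f(a,b,c)$ through determinants by replacing $a_X,b_X,c_X$ by $A_X,B_X,C_X$; the arguments displayed in the claim are substituted for $A,B,C$. The $6j$-symbol is by definition the convolution over pairs of dual bases of the four $3j$-symbols attached to $f_1$ (for $\bar V^1,\bar V^2,U$), $f_2$ (for $\bar U,\bar V^3,W$), $f_3$ (for $V^2,V^3,\bar H$), $f_4$ (for $V^1,H,\bar W$), the contragredient representations (bars) being realized by polynomials in $\partial/\partial A_X$; the $6j$-symbol to which the theorem refers is the one in the form displayed in the claim. In that expression the product is expanded as if variables and differential operators commuted, then in each resulting monomial the differential operators are applied to the variables, and all variables are set to zero. Variables $Z$. With each block occurring in $f_i$ and each summand $\alpha$ of its fixed expression one associates a variable $Z_\alpha=[a^{p_\alpha}b^{q_\alpha}c^{r_\alpha}]$ and the number $z_\alpha$; variables of different blocks are regarded as different. The collection for $f_i$ is denoted $Z^i$, with variables $Z^i_\alpha$ and numbers $z^i_\alpha$. Then $f_i$ is regarded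 as the polynomial $\prod\frac1{t!}\big(\sum_\alpha z^i_\alpha Z^i_\alpha\big)^t$ in the variables $Z^i$; its support $\mathrm{supp}_{Z^i}f_i\subset\mathbb{Z}^M$ is the set of exponents of its monomials ($M$ is the number of variables in $Z^i$, possibly depending on $i$). Put $\mathcal{H}=\mathrm{supp}_{Z^1}f_1\oplus\mathrm{supp}_{Z^2}f_2\oplus\mathrm{supp}_{Z^3}f_3\oplus\mathrm{supp}_{Z^4}f_4\subset(\mathbb{Z}^M)^{\oplus4}$. Projection and lattice $D$. Let $m=3(2^n-2)$. The variable $A^j_X$ occurring in $f_i$ (after replacing each differential operator $\partial/\partial A^j_X$ by $A^j_X$) is denoted $A^j_{X,i}$, and $e^{A^j_{X,i}}$ is the corresponding basis vector of $\bigoplus_{i=1}^4\mathbb{Z}^m$. The map $pr=\oplus_i pr^i:(\mathbb{Z}^M)^{\oplus4}\to(\mathbb{Z}^m)^{\oplus4}$ is the linear map of exponents induced by replacing each variable $Z^i_\alpha=[a^{p}b^{q}c^{r}]$ by the corresponding monomial in the variables $A^j_{X,i}$ which are the arguments of $f_i$. The lattice $D\subset\bigoplus_{i=1}^4\mathbb{Z}^m$ is generated, for all nonempty proper $X\subset\{1,\dots,n\}$, by $e^{A^1_{X,1}}+e^{A^1_{X,4}}$, $e^{A^2_{X,1}}+e^{A^2_{X,3}}$, $e^{A^3_{X,2}}+e^{A^3_{X,3}}$, $e^{A^4_{X,1}}+e^{A^4_{X,2}}$, $e^{A^5_{X,2}}+e^{A^5_{X,4}}$, $e^{A^6_{X,3}}+e^{A^6_{X,4}}$.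 Notation in $\mathcal{J}_\gamma$. The set $\mathcal{H}\cap pr^{-1}(D)$ is written in the form $\varkappa+L$ (shifted lattice; all of its elements have non-negative coordinates); $\gamma$ is only part of the notation. $\mathcal{Z}^x$ is a multi-index power and $\Gamma(x+1)=\prod_s\Gamma(x_s+1)$ over the coordinates of $x$. For $pr(x)\in D$, let $d_{j,X}(x)$ be the coefficient of the generator of $D$ corresponding to $(j,X)$, i.e. the common exponent of $A^j_X$ in the two functions $f_i$ that contain it; then $\Gamma(pr(x)+1)=\prod_{j=1}^{6}\prod_X\Gamma(d_{j,X}(x)+1)$. If the set is empty the sum is $0$. *)

(* Defs.v *)
From mathcomp Require Export all_boot all_order all_algebra all_fingroup.
From mathcomp Require Export boolp classical_sets fsbigop.
From mathcomp Require Export mpoly.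

Set Implicit Arguments.
Unset Strict Implicit.
Unset Printing Implicit Defensive.

Import GRing.Theory.

Local Open Scope classical_set_scope.
Local Open Scope ring_scope.

(* All numberings are shifted by one: 'I_n stands for {1, ..., n}, and
   'I_3 = {a, b, c}. *)

(* An irreducible representation of gl_n is given by its highest weight
   [m_1, ..., m_n], here with m_n = 0. *)
Record hweight (n : nat) := HWeight {
  weight :> 'I_n -> nat;
  weight_dominant : forall i j : 'I_n, (i <= j)%N -> (weight j <= weight i)%N;
  weight_last : forall i : 'I_n, i.+1 = n -> weight i = 0%N }.

Definition pset (n : nat) : Type :=
  {X : {set 'I_n} | (X != finset.set0) && (X != finset.setT)}.

Section Blocks.
Variable n : nat.

(* A letter is (kind, upper index, column): the kind is one of a, b, c, and the
   letter is placed in the box (upper index, column) of the Young diagram of its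
   kind.  The order of the letters inside a row is part of the data, so every
   way of placing the letters into the diagrams is allowed. *)
Definition letter : Type := ('I_3 * 'I_n * nat)%type.

Definition block : Type := seq (n.-tuple letter).

Section OneBlock.
Variable b : block.

(* (i, p) is the p-th letter of the i-th bracket. *)
Definition slot : Type := ('I_(size b) * 'I_n)%type.

Definition slot_letter (t : slot) : letter := tnth (tnth (in_tuple b) t.1) t.2.
Definition kind (t : slot) : 'I_3 := (slot_letter t).1.1.
Definition upper (t : slot) : 'I_n := (slot_letter t).1.2.
Definition column (t : slot) : nat := (slot_letter t).2.

Definition mult (s : 'I_3) (k : 'I_n) : nat :=
  #|[pred t : slot | (kind t == s) && (upper t == k)]|.

(* The last two conditions say that, for each kind, (upper, column) is a
   bijection from the letters onto the boxes of the Young diagram. *)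
Definition is_block : Prop :=
  [/\ b <> [::],
      forall (s : 'I_3) (i j : 'I_n), (i <= j)%N -> (mult s j <= mult s i)%N,
      forall t, (column t < mult (kind t) (upper t))%N
    & injective slot_letter].

Definition row_perm_of (p : {perm slot}) : bool :=
  [forall t, (kind (p t) == kind t) && (upper (p t) == upper t)].

Definition col_perm_of (q : {perm slot}) : bool :=
  [forall t, (kind (q t) == kind t) && (column (q t) == column t)].

End OneBlock.

Section Matrices.
Variable F : fieldType.

(* The polynomial ring in the matrix elements x^j_i, x = a, b, c. *)
Definition mxvar : Type := ('I_3 * 'I_n * 'I_n)%type.
Definition mxpol := {mpoly F[#|{: mxvar}|]}.

Definition mxelt (s : 'I_3) (i j : 'I_n) : mxpol :=
  'X_(enum_rank ((s, i, j) : mxvar)).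

Lemma card_pset_le (X : pset n) : (#|val X| <= n)%N.
Proof. by rewrite -[X in (_ <= X)%N]card_ord max_card. Qed.

(* a_X: rows X in increasing order, columns 1, ..., #|X|. *)
Definition mxdet (s : 'I_3) (X : pset n) : mxpol :=
  \det (\matrix_(r < #|val X|, k < #|val X|)
          mxelt s (enum_val r) (widen_ord (card_pset_le X) k)).

(* The product of the brackets, the letter t carrying the upper index u t. *)
Definition bracket_poly (b : block) (u : slot b -> 'I_n) : mxpol :=
  \prod_(i < size b) \sum_(sg : {perm 'I_n})
    (-1) ^+ sg * \prod_(p < n) mxelt (kind ((i, p) : slot b)) (sg p) (u (i, p)).

(* A permutation of the boxes turns the assignment u of upper indices into
   u \o q; antisymmetrization over columns acts first:
   u |-> sum_q sgn(q) u \o q |-> sum_p sum_q sgn(q) u \o q \o p.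
   The sums run over permutations preserving the kinds, i.e. over products of
   the column (row) groups of the three diagrams. *)
Definition block_poly (b : block) : mxpol :=
  \sum_(p : {perm slot b} | row_perm_of p)
  \sum_(q : {perm slot b} | col_perm_of q)
    (-1) ^+ q * bracket_poly (fun t => upper (q (p t))).

(* A formal polynomial in determinants: a family of summands
   (z_alpha, (p_alpha, q_alpha, r_alpha)). *)
Definition summand : Type := (F * {ffun 'I_3 * pset n -> nat})%type.
Definition detexpr : Type := seq summand.

Definition detexpr_eval (S : comNzRingType) (iota : F -> S)
    (v : 'I_3 -> pset n -> S) (e : detexpr) : S :=
  \sum_(tau <- e)
    iota tau.1 * \prod_(sX : 'I_3 * pset n) v sX.1 sX.2 ^+ tau.2 sX.

(* E chooses an expression for each building block in which the upper index n
   does not occur; these are the blocks that involve only determinants of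
   size < n. *)
Definition fixed_expressions (E : block -> detexpr) : Prop :=
  forall b : block, is_block b -> (forall t : slot b, ((upper t).+1 < n)%N) ->
    detexpr_eval (fun c => c%:MP) mxdet (E b) = block_poly b.

End Matrices.

(* A semi-invariant of product form, \prod (1/t!) block^t, given by its
   distinct blocks and their exponents. *)
Record prodform := ProdForm {
  factors : seq (block * nat);
  factors_uniq : uniq (unzip1 factors);
  factors_block : forall b, b \in unzip1 factors -> is_block b }.

Definition upper_count (f : prodform) (s : 'I_3) (k : 'I_n) : nat :=
  (\sum_(bt <- factors f) bt.2 * mult bt.1 s k)%N.

Definition has_type (f : prodform) (V W U : hweight n) : Prop :=
  forall (s : 'I_3) (k : 'I_n), upper_count f s k = tnth [tuple V; W; U] s k.

End Blocks.

(* The indices of A^1, ..., A^6 and of f_1, ..., f_4. *)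
Definition j1 : 'I_6 := @Ordinal 6 0 isT.
Definition j2 : 'I_6 := @Ordinal 6 1 isT.
Definition j3 : 'I_6 := @Ordinal 6 2 isT.
Definition j4 : 'I_6 := @Ordinal 6 3 isT.
Definition j5 : 'I_6 := @Ordinal 6 4 isT.
Definition j6 : 'I_6 := @Ordinal 6 5 isT.
Definition i1 : 'I_4 := @Ordinal 4 0 isT.
Definition i2 : 'I_4 := @Ordinal 4 1 isT.
Definition i3 : 'I_4 := @Ordinal 4 2 isT.
Definition i4 : 'I_4 := @Ordinal 4 3 isT.

Section SixJ.
Variables (F : fieldType) (n : nat) (E : block n -> detexpr n F).

(* f(A, B, C), computed from the fixed expressions of the blocks of f. *)
Definition prodform_eval (S : comNzRingType) (iota : F -> S) (f : prodform n)
    (A B C : pset n -> S) : S :=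
  \prod_(bt <- factors f)
    (iota (bt.2`!%:R^-1)
     * detexpr_eval iota (tnth [tuple A; B; C]) (E bt.1) ^+ bt.2).

Definition Avar : Type := ('I_6 * pset n)%type.

(* Polynomials in commuting symbols d/dA^j_X, with coefficients the polynomials
   in the A^j_X. *)
Definition Apol := {mpoly F[#|{: Avar}|]}.
Definition diffpol := {mpoly Apol[#|{: Avar}|]}.

Definition varA (j : 'I_6) (X : pset n) : diffpol :=
  ('X_(enum_rank ((j, X) : Avar)) : Apol)%:MP.
Definition derA (j : 'I_6) (X : pset n) : diffpol :=
  'X_(enum_rank ((j, X) : Avar)).

(* The monomials in d/dA are applied to their coefficients, and then all the
   variables are set to 0. *)
Definition apply_at0 (P : diffpol) : F :=
  (\sum_(u <- msupp P) mderivm u P@_u).@[fun=> 0].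

Definition sixj (f1 f2 f3 f4 : prodform n) : F :=
  let ev := @prodform_eval diffpol (fun c => c%:MP%:MP) in
  apply_at0 (ev f1 (derA j1) (derA j2) (varA j4)
           * ev f2 (derA j4) (derA j3) (varA j5)
           * ev f3 (varA j2) (varA j3) (derA j6)
           * ev f4 (varA j1) (varA j6) (derA j5)).

Section Zvariables.
Variable f : prodform n.

Definition factor (i : 'I_(size (factors f))) : block n * nat :=
  tnth (in_tuple (factors f)) i.

(* Z_alpha: a block of f together with a summand of its fixed expression. *)
Definition Zvar : Type :=
  {i : 'I_(size (factors f)) & 'I_(size (E (factor i).1))}.

Definition Zsummand (v : Zvar) : summand n F :=
  tnth (in_tuple (E (factor (tag v)).1)) (tagged v).

Definition prodform_Z : {mpoly F[#|{: Zvar}|]} :=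
  \prod_(i < size (factors f))
    ((factor i).2`!%:R^-1
     *: (\sum_(v : Zvar | tag v == i) (Zsummand v).1 *: 'X_(enum_rank v))
        ^+ (factor i).2).

Definition suppZ : set {ffun Zvar -> int} :=
  [set x | exists2 m, m \in msupp prodform_Z
                    & forall v, x v = (m (enum_rank v))%:Z].

End Zvariables.

Section Quadruple.
Variable f : 'I_4 -> prodform n.

(* The collection {Z^1, Z^2, Z^3, Z^4}, so that {ffun Zall -> int} is the direct
   sum of the lattices Z^M. *)
Definition Zall : Type := {i : 'I_4 & Zvar (f i)}.

Definition Zcomp (x : {ffun Zall -> int}) (i : 'I_4) : {ffun Zvar (f i) -> int} :=
  [ffun v : Zvar (f i) => x (Tagged (fun i => Zvar (f i)) v)].

Definition Znumber (v : Zall) : F := (Zsummand (tagged v)).1.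

Definition Hset : set {ffun Zall -> int} :=
  [set x | forall i, suppZ (Zcomp x i)].

(* The s-th argument of f_i, up to replacing d/dA^j by A^j. *)
Definition arg (i : 'I_4) (s : 'I_3) : 'I_6 :=
  tnth (tnth [tuple [tuple j1; j2; j4]; [tuple j4; j3; j5];
                    [tuple j2; j3; j6]; [tuple j1; j6; j5]] i) s.

(* The coordinate (i, s, X) corresponds to A^j_{X,i} with j = arg i s; the
   three arguments of each f_i are different. *)
Definition Aexp : Type := {ffun 'I_4 * 'I_3 * pset n -> int}.

Definition eA (j : 'I_6) (X : pset n) (i : 'I_4) : Aexp :=
  [ffun k => ((k.1.1 == i) && (arg k.1.1 k.1.2 == j) && (k.2 == X))%:R].

Definition pr (x : {ffun Zall -> int}) : Aexp :=
  [ffun k => \sum_(v : Zvar (f k.1.1))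
               Zcomp x k.1.1 v * ((Zsummand v).2 (k.1.2, k.2))%:Z].

Definition Dgen (jX : Avar) : Aexp :=
  let: (j, X) := jX in
  tnth [tuple eA j1 X i1 + eA j1 X i4; eA j2 X i1 + eA j2 X i3;
              eA j3 X i2 + eA j3 X i3; eA j4 X i1 + eA j4 X i2;
              eA j5 X i2 + eA j5 X i4; eA j6 X i3 + eA j6 X i4] j.

Definition Dcomb (d : {ffun Avar -> int}) : Aexp := \sum_jX Dgen jX *~ d jX.

Definition Dlattice : set Aexp := range Dcomb.

(* The coefficients d_{j,X} of the generators in an element of the lattice;
   they are unique, the generators being linearly independent. *)
Definition Dcoef (y : Aexp) : {ffun Avar -> int} :=
  xget 0 [set d | Dcomb d = y].

(* The gamma function at integers; the junk value 0 at its poles makes 1/Gamma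
   vanish there (0^-1 = 0). *)
Definition Gamma (k : int) : F := if k is Posz m.+1 then m`!%:R else 0.

Definition Jgamma (Z : Zall -> F) : F :=
  \sum_(x \in Hset `&` pr @^-1` Dlattice)
    (\prod_jX Gamma (Dcoef (pr x) jX + 1)) * (\prod_v Z v ^ x v)
    / \prod_v Gamma (x v + 1).

End Quadruple.
End SixJ.

(* Main.v *)
(* The exponential weights 1/t! turn f_i, as a polynomial in Z^i, into a product
   of divided powers of linear forms in disjoint sets of variables, whose
   coefficient at a monomial Z^x of its support is z^x / x!.  Substituting
   Z |-> [a^p b^q c^r] and expanding the product of the four f_i, a quadruple x
   of supports contributes z^x / x! times a monomial A^u (d/dA)^v whose exponents
   are the coordinates of pr(x).  At A = 0 it gives u! if u = v and 0 otherwise;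
   since every A^j occurs in exactly two of the f_i, once as a variable and once
   as a derivative, u = v means that pr(x) lies in D, and then u! is
   Gamma(pr(x) + 1). *)
Require Import Defs.
From mathcomp Require Import bigenough ssrcomplements.
Set Implicit Arguments.
Unset Strict Implicit.
Unset Printing Implicit Defensive.
Import GRing.Theory BigEnough.
Local Open Scope ring_scope.

(** * Coefficients of products of divided powers of linear forms *)

Lemma mderiv_exp (R : comNzRingType) N (i : 'I_N) (p : {mpoly R[N]}) k :
  mderiv i (p ^+ k) = (p ^+ k.-1 * mderiv i p) *+ k.
Proof.
elim: k => [|k IH]; first by rewrite expr0 -mpolyC1 mderivC mulr0n.
rewrite exprS mderivM IH mulrnAr mulrA mulrC.
case: k {IH} => [|k] /=; first by rewrite !mulr0n addr0.
by rewrite -exprS [RHS]mulrS.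
Qed.

Lemma mderiv_prod_eq0 (R : comNzRingType) N (i : 'I_N) (I : Type) (r : seq I)
    (P : pred I) (p : I -> {mpoly R[N]}) :
  (forall j, P j -> mderiv i (p j) = 0) -> mderiv i (\prod_(j <- r | P j) p j) = 0.
Proof.
move=> p0; elim/big_rec: _ => [|j q Pj q0]; first by rewrite -mpolyC1 mderivC.
by rewrite mderivM q0 p0 // mul0r mulr0 addr0.
Qed.

Section ProductsOfLinearForms.
Variables (F : fieldType) (F_char0 : [pchar F] =i pred0).
Variables (T I : finType) (g : T -> I) (z : T -> F).

(** The fibres of [g] partition the variables, so forms with different indices share no variable. *)
Definition linear_form (i : I) : {mpoly F[#|T|]} :=
  \sum_(v | g v == i) z v *: 'X_(enum_rank v).

Definition divided_powers (t : I -> nat) : {mpoly F[#|T|]} :=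
  \prod_i ((t i)`!%:R^-1 *: linear_form i ^+ t i).

Lemma mderiv_linear_form v i :
  mderiv (enum_rank v) (linear_form i) = (z v *+ (g v == i))%:MP.
Proof.
have dX w : mderiv (enum_rank v) 'X_(enum_rank w) = (w == v)%:R :> {mpoly F[#|T|]}.
  rewrite mderivX mnm1E (inj_eq enum_rank_inj).
  case: eqVneq => [->|_]; last by rewrite scale0r.
  by rewrite scale1r -{1}[U_(_)%MM]add0m addmK mpolyX0.
rewrite raddf_sum /=; under eq_bigr do rewrite mderivZ dX.
have [gv|gv] := eqVneq (g v) i.
  rewrite (bigD1 v) ?gv //= big1 ?addr0 => [|w /andP[_ /negPf->]]; last first.
    by rewrite scaler0.
  by rewrite eqxx -mul_mpolyC mulr1.
rewrite mulr0n mpolyC0 big1 // => w /eqP gw.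
by case: (eqVneq w v) gv => [<-|_ _]; rewrite ?gw ?eqxx ?scaler0.
Qed.

(** Only the form of index [g v] contains the variable [v], and t/t! = 1/(t-1)!, so divided powers
    are stable under differentiation up to a scalar. *)
Lemma mderiv_divided_powers v t :
  mderiv (enum_rank v) (divided_powers t) =
  if t (g v) is k.+1
  then z v *: divided_powers (fun i => if i == g v then k else t i) else 0.
Proof.
rewrite /divided_powers (bigD1 (g v)) //= mderivM [X in _ + _ * X]mderiv_prod_eq0.
  rewrite mulr0 addr0 mderivZ mderiv_exp mderiv_linear_form eqxx mulr1n.
  case E: (t (g v)) => [|k]; first by rewrite mulr0n scaler0 mul0r.
  rewrite [X in _ = _ *: X](bigD1 (g v)) //= eqxx scalerAl; congr (_ * _); last first.
    by apply: eq_bigr => i /negPf->.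
  rewrite mulrC mul_mpolyC -scaler_nat !scalerA; congr (_ *: _).
  rewrite factS natrM invfM mulrC; congr (_ * _).
  by rewrite mulrAC mulVf ?mul1r // (pcharf0P F).1.
move=> i /negPf gi.
by rewrite mderivZ mderiv_exp mderiv_linear_form eq_sym gi mpolyC0 mulr0 mul0rn scaler0.
Qed.

(** Differentiation removes one variable at a time, which replaces a multinomial expansion. The
    exponents [t] only decide which monomials occur, so they are absent from the coefficient. *)
Lemma mcoeff_divided_powers t m : m \in msupp (divided_powers t) ->
  (divided_powers t)@_m =
  \prod_v z v ^+ m (enum_rank v) / \prod_v (m (enum_rank v))`!%:R.
Proof.
rewrite mcoeff_msupp.
(* Induction on the degree for all [t] at once, since a derivative lowers one of the exponents. *)
move: {2}(mdeg m) (erefl (mdeg m)) => d; elim: d m t => [|d IH] m t.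
  move/eqP; rewrite mdeg_eq0 => /eqP-> {m}.
  rewrite [X in _ -> _ = X / _]big1 => [|v _]; last by rewrite mnm0E.
  rewrite [X in _ -> _ = _ / X]big1 => [|v _]; last by rewrite mnm0E.
  (* The forms have no constant term, so a nonzero coefficient at 0 forces every [t i] to be 0. *)
  have coef_prod : (divided_powers t)@_0 = \prod_i ((t i)`!%:R^-1 * 0 ^+ t i).
    rewrite -[LHS]/(mcoeff 0%MM _) rmorph_prod; apply: eq_bigr => i _ /=.
    rewrite mcoeffZ rmorphXn; congr (_ * _ ^+ _).
    rewrite /= raddf_sum big1 // => v _ /=.
    by rewrite mcoeffZ mcoeffX mnm1_eq0 mulr0.
  rewrite coef_prod divr1 => nz; apply: big1 => i _.
  move/prodf_neq0: nz => /(_ i isT).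
  case: (t i) => [|k]; last by rewrite expr0n mulr0 eqxx.
  by rewrite fact0 invr1 mulr1.
move=> degm nz.
have [v mv] : exists v, (0 < m (enum_rank v))%N.
  apply/existsP; apply: contra_eqT degm => /existsPn m0.
  rewrite (_ : m = 0%MM) ?mdeg0 //; apply/mnmP => i; rewrite mnm0E.
  by move: (m0 (enum_val i)); rewrite enum_valK -leqNgt leqn0 => /eqP.
pose m' := (m - U_(enum_rank v))%MM.
have mE : m = (m' + U_(enum_rank v))%MM.
  by rewrite submK //; apply/mnm_lepP => i; rewrite mnm1E; case: eqP => [<-|].
have degm' : mdeg m' = d by move: degm; rewrite mE mdegD mdeg1 addn1 => -[].
have m'E w : m (enum_rank w) = (m' (enum_rank w) + (v == w))%N.
  by rewrite mE mnmDE mnm1E (inj_eq enum_rank_inj).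
have := mcoeff_mderiv (enum_rank v) (divided_powers t) m'.
rewrite -mE mderiv_divided_powers.
have Sneq0 k : k.+1%:R != 0 :> F by rewrite (pcharf0P F).1.
(* With exponent 0 the derivative vanishes, while its coefficient at [m'] is a positive integer
   times the nonzero coefficient at [m]: impossible in characteristic 0. *)
case E: (t (g v)) => [|k].
  rewrite mcoeff0 => /esym/eqP.
  by rewrite -mulr_natr mulf_eq0 (negPf nz) (negPf (Sneq0 _)).
rewrite mcoeffZ -mulr_natr => eqn.
have nz' : (divided_powers (fun i => if i == g v then k else t i))@_m' != 0.
  apply: contraNneq nz => c0; move/esym/eqP: eqn.
  by rewrite c0 mulr0 mulf_eq0 (negPf (Sneq0 _)) orbF.
move: eqn; rewrite (IH _ _ degm' nz') => eqn.
(* The exponent of [v] in [m] is one more than in [m']; this factor turns the factorials of [m']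
   into those of [m]. *)
apply: (mulIf (Sneq0 (m' (enum_rank v)))); rewrite -{}eqn.
rewrite (bigD1 v) // [X in _ / X](bigD1 v) // [in RHS](bigD1 v) //.
rewrite [X in _ = _ / X * _](bigD1 v) //= m'E eqxx addn1 exprS factS natrM.
under [X in _ = _ * X / _ * _]eq_bigr => w /negPf wv do rewrite m'E eq_sym wv addn0.
under [X in _ = _ / (_ * X) * _]eq_bigr => w /negPf wv do rewrite m'E eq_sym wv addn0.
rewrite -!mulrA; do 3!congr (_ * _).
by rewrite [in RHS]invfM mulrAC mulVf ?mul1r.
Qed.

End ProductsOfLinearForms.

(** * Finite sums over dependent choices *)

Lemma big_seq_sub (R : Type) (idx : R) (op : Monoid.com_law idx) (T : choiceType)
    (s : seq T) (F : T -> R) : uniq s ->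
  \big[op/idx]_(x <- s) F x = \big[op/idx]_(x : seq_sub s) F (ssval x).
Proof.
move=> s_uniq; rewrite (big_mksub (seq_sub s)) //.
by apply: eq_bigl => x; apply: ssvalP.
Qed.

(** The index type varies with the factor, so ordinary distributivity is applied on the disjoint
    union of the [T i]; [untag] has value 0 off the tag [i]. *)
Lemma prod_sum_fprod (S : comPzSemiRingType) (I : finType) (T : I -> finType)
    (P : forall i, T i -> S) :
  \prod_i \sum_(x : T i) P i x = \sum_(x : fprod T) \prod_i P i (x i).
Proof.
under [RHS]eq_bigr => x do under eq_bigr => i do rewrite -[P i (x i)](ffunE (P i)).
rewrite (big_fprod _ _ (fun i => [ffun x => P i x])).
rewrite -(bigA_distr_big_dep (fun i => mem (tagged_with T i))
  (fun i => untag 0 [ffun x => P i x])).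
apply: eq_bigr => i _; rewrite (big_tag _ i) /=.
apply: eq_bigr => j /eqP ji; case: j ji => k y /= <- {i}.
by rewrite !untagE //= ffunE.
Qed.

(** * Pairing each A^j with d/dA^j among the twelve arguments *)

Definition is_derivative (i : 'I_4) (s : 'I_3) : bool :=
  tnth (tnth [tuple [tuple true; true; false]; [tuple true; true; false];
                    [tuple false; false; true]; [tuple false; false; true]] i) s.

Definition s1 : 'I_3 := @Ordinal 3 0 isT.
Definition s2 : 'I_3 := @Ordinal 3 1 isT.
Definition s3 : 'I_3 := @Ordinal 3 2 isT.

(* The place (i, s) such that A^j, or d/dA^j when der = true, is the s-th
   argument of f_i; each of them occurs exactly once. *)
Definition place (j : 'I_6) (der : bool) : 'I_4 * 'I_3 :=
  if der
  then tnth [tuple (i1, s1); (i1, s2); (i2, s2); (i2, s1); (i4, s3); (i3, s3)] j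
  else tnth [tuple (i4, s1); (i3, s1); (i3, s2); (i1, s3); (i2, s3); (i4, s2)] j.

Arguments place : simpl never.

Lemma placeK : cancel (fun jd : 'I_6 * bool => place jd.1 jd.2)
                      (fun k => (arg k.1 k.2, is_derivative k.1 k.2)).
Proof.
move=> [[[|[|[|[|[|[|//]]]]]] lt_j6] []]; congr pair => //; exact: val_inj.
Qed.

Lemma arg_place j der : arg (place j der).1 (place j der).2 = j.
Proof. by case: (placeK (j, der)). Qed.

Lemma is_derivative_place j der :
  is_derivative (place j der).1 (place j der).2 = der.
Proof. by case: (placeK (j, der)). Qed.

Lemma place_argK : cancel (fun k => (arg k.1 k.2, is_derivative k.1 k.2))
                    (fun jd : 'I_6 * bool => place jd.1 jd.2).
Proof.
move=> [[[|[|[|[|//]]]] lt_i4] [[|[|[|//]]] lt_s3]]; congr pair; exact: val_inj.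
Qed.

Lemma prod_place (S : comPzSemiRingType) (G : 'I_4 * 'I_3 -> S) :
  \prod_k G k = \prod_j (G (place j true) * G (place j false)).
Proof.
rewrite (reindex (fun jd : 'I_6 * bool => place jd.1 jd.2)) /=; last first.
  exact: onW_bij (Bijective placeK place_argK).
rewrite -(pair_bigA _ (fun j d => G (place j d))) /=.
by apply: eq_bigr => j _; rewrite big_bool.
Qed.

(** * The lattice D and the evaluation at A = 0 *)

Section Monomials.
Variables (F : fieldType) (n : nat).

(** Since A^j is an argument of exactly two of the f_i, the two basis vectors of a generator
    together mark every occurrence of A^j_X. *)
Lemma DgenE (j : 'I_6) (X : pset n) k :
  Dgen (j, X) k = ((arg k.1.1 k.1.2 == j) && (k.2 == X))%:R.
Proof.
have DgenEA : Dgen (j, X) = eA j X (place j true).1 + eA j X (place j false).1.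
  by case: j => [[|[|[|[|[|[|//]]]]]] lt_j6]; rewrite [RHS]addrC // addrC.
rewrite DgenEA !ffunE.
case: k => [[[[|[|[|[|//]]]] lt_i4] [[|[|[|//]]] lt_s3]] Y] /=;
 case: j {DgenEA} => [[|[|[|[|[|[|//]]]]]] lt_j6] /=;
 by case: (Y == X).
Qed.

Lemma DcombE (d : {ffun Avar n -> int}) k :
  Dcomb d k = d (arg k.1.1 k.1.2, k.2).
Proof.
rewrite /Dcomb sum_ffunE (bigD1 (arg k.1.1 k.1.2, k.2)) //= big1 => [|jX].
  by rewrite ffunMzE DgenE !eqxx addr0 intz.
case: jX => j X; rewrite ffunMzE DgenE xpair_eqE eq_sym [X == _]eq_sym.
by move/negPf->; rewrite mul0rz.
Qed.

(** The generators have disjoint supports, so each coefficient is read off at one place; this makes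
    the choice in [Dcoef] unambiguous. *)
Lemma Dcomb_inj : injective (@Dcomb n).
Proof.
move=> d d' dd'; apply/ffunP => -[j X].
by move/ffunP/(_ (place j true, X)): dd'; rewrite !DcombE arg_place.
Qed.

Lemma DcombK : cancel (@Dcomb n) (@Dcoef n).
Proof.
move=> d; apply: Dcomb_inj; rewrite /Dcoef.
have ex_d : exists d', [set d' | Dcomb d' = Dcomb d]%classic d' by exists d.
exact: (classical_sets.xgetPex 0 ex_d).
Qed.

Lemma meval0_mcoeff N (R : comNzRingType) (p : {mpoly R[N]}) :
  p.@[fun=> 0] = p@_0.
Proof.
rewrite mevalE {3}[p]mpolyE raddf_sum /=; apply: eq_bigr => m _.
rewrite mcoeffZ mcoeffX; congr (_ * _).
have [->|/eqP m0] := eqVneq m 0%MM; first by rewrite big1 // => i _; rewrite mnm0E.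
case: (pickP (fun i => m i != 0%N)) => [i mi|m0'].
  by rewrite (bigD1 i) //= expr0n (negPf mi) mul0r.
by case: m0; apply/mnmP => i; rewrite mnm0E; move/negbFE/eqP: (m0' i).
Qed.

(** At 0, the derivative of order u keeps only the coefficient of A^u, times u!. A range of
    summation independent of the support makes additivity visible. *)
Lemma apply_at0E k (P : diffpol F n) : (msize P <= k)%N ->
  apply_at0 P = \sum_(u : 'X_{1..#|{: Avar n}| < k})
                  P@_u@_u *+ (\prod_i (u i)`!).
Proof.
move=> le_Pk; rewrite /apply_at0 raddf_sum /=.
have termE u : (mderivm u P@_u).@[fun=> 0] = P@_u@_u *+ (\prod_i (u i)`!)%N.
  rewrite meval0_mcoeff mcoeff_mderivm addm0; congr (_ *+ _).
  by apply: eq_bigr => i _; rewrite ffactnn.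
under eq_bigr do rewrite termE.
rewrite (big_mksub 'X_{1..#|{: Avar n}| < k}) ?msupp_uniq //=; last first.
  by move=> x /msize_mdeg_lt /leq_trans; apply.
by rewrite big_rmcond //= => u /memN_msupp_eq0 ->; rewrite mcoeff0 mul0rn.
Qed.

Lemma apply_at0_sum (I : Type) (r : seq I) (P : I -> diffpol F n) :
  apply_at0 (\sum_(i <- r) P i) = \sum_(i <- r) apply_at0 (P i).
Proof.
apply: big_morph => [p q|]; last by rewrite /apply_at0 msupp0 big_nil meval0.
(* One bound [k] serves both summands and their sum. *)
pose_big_enough k.
  rewrite !(@apply_at0E k) // -big_split; apply: eq_bigr => u _ /=.
  by rewrite !mcoeffD mulrnDl.
by close.
Qed.

Lemma apply_at0_monomial (c : F) a b :
  apply_at0 ((c%:MP * 'X_[a])%:MP * 'X_[b] : diffpol F n) =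
  if a == b then c * (\prod_i (b i)`!)%:R else 0.
Proof.
pose_big_enough k.
  rewrite (@apply_at0E k) //.
  have lt_bk : (mdeg b < k)%N by [].
  rewrite (bigD1 (Sub b lt_bk)) //= [X in _ + X]big1 => [|u]; last first.
    rewrite eqE /= eq_sym => /negPf ub.
    by rewrite mcoeffCM mcoeffX ub mulr0 mcoeff0 mul0rn.
  rewrite addr0 mcoeffCM mcoeffX eqxx mulr1 mcoeffCM mcoeffX.
  by case: eqP => _ /=; [rewrite mulr1 mulr_natr | rewrite mulr0 mul0rn].
by close.
Qed.

Lemma varA_monomial (a : 'X_{1..#|{: Avar n}|}) :
  \prod_jX varA F jX.1 jX.2 ^+ a (enum_rank jX) = ('X_[a])%:MP.
Proof.
rewrite mpolyXE_id rmorph_prod (reindex (@enum_rank (Avar n))) /=.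
  by apply: eq_bigr => -[j X] _; rewrite rmorphXn.
exact/onW_bij/enum_rank_bij.
Qed.

Lemma derA_monomial (b : 'X_{1..#|{: Avar n}|}) :
  \prod_jX derA F jX.1 jX.2 ^+ b (enum_rank jX) = 'X_[b].
Proof.
rewrite mpolyXE_id (reindex (@enum_rank (Avar n))) /=.
  by apply: eq_bigr => -[j X] _.
exact/onW_bij/enum_rank_bij.
Qed.

End Monomials.

(** * Expansion of the f_i in the variables Z *)

Section Expansion.
Variables (F : fieldType) (n : nat) (E : block n -> detexpr n F).

(** Different blocks own different variables, so [prodform_Z] is an instance of [divided_powers]
    with [tag] as grouping map. *)
Lemma mcoeff_prodform_Z (F_char0 : [pchar F] =i pred0) f m :
  m \in msupp (prodform_Z E f) ->
  (prodform_Z E f)@_m =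
  \prod_v ((Zsummand v).1 ^+ m (enum_rank v) / (m (enum_rank v))`!%:R).
Proof.
rewrite prodf_div; exact: (@mcoeff_divided_powers _ F_char0 (Zvar E f) _
  (fun v => tag v) (fun v => (Zsummand v).1) (fun i => (factor i).2)).
Qed.

(** The monomial [a^p b^q c^r] that is substituted for Z_alpha. *)
Definition Zmonomial (S : comNzRingType) (f : prodform n)
    (A : 'I_3 -> pset n -> S) (v : Zvar E f) : S :=
  \prod_sX A sX.1 sX.2 ^+ (Zsummand v).2 sX.

(** Substitution is a ring morphism, so only the linear form of each block has to be compared with
    its fixed expression. *)
Lemma prodform_eval_Z (S : comNzRingType) (iota : {rmorphism F -> S})
    (f : prodform n) (A B C : pset n -> S) :
  prodform_eval E iota f A B C =
  mmap iota (fun k => Zmonomial (tnth [tuple A; B; C]) (enum_val k))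
    (prodform_Z E f).
Proof.
rewrite rmorph_prod /prodform_eval big_tnth; apply: eq_bigr => i _.
rewrite /= mmapZ rmorphXn; congr (_ * _ ^+ _).
rewrite raddf_sum /detexpr_eval /= big_tnth.
(* The sum over summands becomes a double sum with outer index restricted to [i], to match the sum
   over dependent pairs with tag [i]. *)
rewrite -(big_pred1_eq +%R i (fun i => \sum_(j < size (E (factor i).1)) _)).
rewrite sig_big_dep /=; apply: eq_big => [v|v _]; first by rewrite andbT.
by rewrite mmapZ mmapX mmap1U enum_rankK.
Qed.

Lemma mmap1_Zmonomial (S : comNzRingType) f (A : 'I_3 -> pset n -> S)
    (m : 'X_{1..#|{: Zvar E f}|}) :
  mmap1 (fun k => Zmonomial A (enum_val k)) m =
  \prod_sX A sX.1 sX.2 ^+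
    (\sum_(v : Zvar E f) m (enum_rank v) * (Zsummand v).2 sX).
Proof.
rewrite /mmap1 (reindex (@enum_rank (Zvar E f))) /=; last first.
  exact/onW_bij/enum_rank_bij.
under eq_bigr do rewrite enum_rankK /Zmonomial -prodrXl.
rewrite exchange_big /=; apply: eq_bigr => sX _.
by rewrite -prodrXr; apply: eq_bigr => v _; rewrite mulnC exprM.
Qed.

(** * Quadruples of monomials as elements of H *)

Section Quadruple.
Variable f : 'I_4 -> prodform n.

(** Makes [fprod Zsupport] a finite model of H, embedded by [exponents]. *)
Definition Zsupport (i : 'I_4) : finType := seq_sub (msupp (prodform_Z E (f i))).

Implicit Type x : fprod Zsupport.

Definition exponents x : {ffun Zall E f -> int} :=
  [ffun v => (ssval (x (tag v)) (enum_rank (tagged v)))%:Z].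

(** The coordinate of pr(x) at the place [k] and the subset [X], as a natural number. *)
Definition degree x (k : 'I_4 * 'I_3) (X : pset n) : nat :=
  \sum_(v : Zvar E (f k.1)) ssval (x k.1) (enum_rank v) * (Zsummand v).2 (k.2, X).

(** The total exponent of the A^j_X for [false], of the d/dA^j_X for [true]. *)
Definition degree_mnm der x : 'X_{1..#|{: Avar n}|} :=
  [multinom degree x (place (enum_val jX).1 der) (enum_val jX).2
    | jX < #|{: Avar n}|].

Lemma degree_mnmE der x jX :
  degree_mnm der x (enum_rank jX) = degree x (place jX.1 der) jX.2.
Proof. by rewrite mnmE enum_rankK. Qed.

Lemma pr_exponents x k : pr (exponents x) k = degree x k.1 k.2 :> int.
Proof.
case: k => [[i s] X]; rewrite /pr ffunE /degree /= (big_morph Posz PoszD erefl).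
apply: eq_bigr => v _.
by rewrite /Zcomp !ffunE.
Qed.

Lemma exponents_inj : injective exponents.
Proof.
move=> x y xy; apply/fprodP => i; apply/val_inj/mnmP => k /=.
move/ffunP/(_ (Tagged (fun i => Zvar E (f i)) (enum_val k : Zvar E (f i)))): xy.
by rewrite !ffunE /= enum_valK => -[].
Qed.

Lemma Hset_exponents : Hset (E := E) (f := f) = [set exponents x | x in setT]%classic.
Proof.
apply/classical_sets.seteqP; split => [y Hy|_ [x _ <-] i]; last first.
  exists (ssval (x i)); first exact: ssvalP.
  by move=> v; rewrite !ffunE.
(* Points of the support have non-negative coordinates, so [absz] loses nothing. *)
pose mnm i : 'X_{1..#|{: Zvar E (f i)}|} :=
  [multinom absz (Zcomp y i (enum_val k)) | k < #|{: Zvar E (f i)}|].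
have mnmP i : (mnm i \in msupp (prodform_Z E (f i))) /\
    forall v, Zcomp y i v = (mnm i (enum_rank v))%:Z.
  have [m m_supp mE] := Hy i.
  suff -> : mnm i = m by [].
  by apply/mnmP => k; rewrite mnmE mE enum_valK absz_nat.
exists [fprod i => SeqSub (mnmP i).1 : Zsupport i] => //.
apply/ffunP => -[i v]; rewrite ffunE /= fprodE /= -(mnmP i).2.
by rewrite ffunE.
Qed.

(** Each A^j has one place as a variable and one as a derivative, and D asks for equal exponents at
    these two. *)
Lemma pr_exponents_Dlattice x :
  Dlattice (pr (exponents x)) <-> degree_mnm false x == degree_mnm true x.
Proof.
split=> [[d _ dE]|/eqP balanced].
  apply/eqP/mnmP => k; rewrite !mnmE; apply/eqP; rewrite -eqz_nat; apply/eqP.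
  rewrite -(pr_exponents x (place _ false, _)) -(pr_exponents x (place _ true, _)) -dE.
  by rewrite !DcombE /= !arg_place.
exists [ffun jX => (degree_mnm true x (enum_rank jX))%:Z] => //.
apply/ffunP => -[k X]; rewrite DcombE ffunE /= pr_exponents /=.
have := congr1 (fun m : 'X_{1.._} => m (enum_rank (arg k.1 k.2, X))) balanced.
(* Every place is the variable place or the derivative place of its own A^j; only the first case
   uses the balance. *)
rewrite !degree_mnmE /= => balanced_k; rewrite -[k in RHS]place_argK /=.
by congr Posz; case: (is_derivative _ _).
Qed.

Lemma Dcoef_pr_exponents x jX : degree_mnm false x = degree_mnm true x ->
  Dcoef (pr (exponents x)) jX = degree_mnm true x (enum_rank jX).
Proof.
move=> balanced; have /eqP/pr_exponents_Dlattice [d _ dE] := balanced.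
rewrite -dE DcombK degree_mnmE -(pr_exponents x (place _ true, _)) -dE DcombE.
by rewrite arg_place; case: jX.
Qed.

(** * The product of the four f_i, term by term *)

Definition symbol (k : 'I_4 * 'I_3) (X : pset n) : diffpol F n :=
  if is_derivative k.1 k.2 then derA F (arg k.1 k.2) X
  else varA F (arg k.1 k.2) X.

Definition symbols (i : 'I_4) : 3.-tuple (pset n -> diffpol F n) :=
  [tuple symbol (i, s1); symbol (i, s2); symbol (i, s3)].

Lemma tnth_symbols i s : tnth (symbols i) s = symbol (i, s).
Proof.
by case: s => [[|[|[|//]]] lt_s3]; congr (symbol (_, _)); apply: val_inj.
Qed.

Lemma prod_symbol x :
  \prod_i mmap1 (fun k => Zmonomial (tnth (symbols i)) (enum_val k))
            (ssval (x i)) =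
  ('X_[degree_mnm false x])%:MP * 'X_[degree_mnm true x].
Proof.
transitivity (\prod_i \prod_s \prod_X symbol (i, s) X ^+ degree x (i, s) X).
  apply: eq_bigr => i _; rewrite mmap1_Zmonomial [RHS]pair_bigA.
  by apply: eq_bigr => -[s X] _; rewrite tnth_symbols.
rewrite (pair_bigA _ (fun i s => \prod_X symbol (i, s) X ^+ degree x (i, s) X)).
rewrite (eq_bigr (fun k => \prod_X symbol k X ^+ degree x k X)) => [|[]//].
(* The twelve places are regrouped into six pairs, one for each A^j. *)
rewrite prod_place -varA_monomial -derA_monomial -big_split /=.
under [RHS]eq_bigr do rewrite !degree_mnmE.
rewrite -(pair_bigA _ (fun j X => varA F j X ^+ degree x (place j false) X
                                * derA F j X ^+ degree x (place j true) X)) /=.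
apply: eq_bigr => j _; rewrite -big_split; apply: eq_bigr => X _.
by rewrite /symbol !is_derivative_place !arg_place mulrC.
Qed.

Lemma prod_Zall (G : Zall E f -> F) :
  \prod_v G v = \prod_i \prod_(v : Zvar E (f i)) G (Tagged (fun i => Zvar E (f i)) v).
Proof. by rewrite sig_big_dep; apply: eq_big => -[]. Qed.

Lemma GammaS k : Gamma F (k%:Z + 1) = k`!%:R.
Proof. by rewrite /Gamma -PoszD addn1. Qed.

Lemma apply_at0_product (F_char0 : [pchar F] =i pred0) :
  apply_at0 (\prod_i prodform_eval E (fun c => c%:MP%:MP) (f i)
               (symbol (i, s1)) (symbol (i, s2)) (symbol (i, s3)))
  = Jgamma (@Znumber F n E f).
Proof.
under eq_bigr do
  rewrite (prodform_eval_Z (@mpolyC _ _ \o @mpolyC _ _)) /mmap.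
under eq_bigr => i _ do rewrite (big_seq_sub _ _ (msupp_uniq _)).
rewrite prod_sum_fprod apply_at0_sum /Jgamma.
(* Through the injective [exponents], the sum over a subset of the lattice becomes a sum over a
   finite type. *)
have -> : (Hset (f := f) `&` @pr F n E f @^-1` @Dlattice n =
    [set exponents x | x in
      [set` [pred x | degree_mnm false x == degree_mnm true x]]])%classic.
  apply/classical_sets.seteqP; split => y /=.
    by rewrite Hset_exponents => -[[x _ <-]] /pr_exponents_Dlattice; exists x.
  move=> [x /pr_exponents_Dlattice bal <-]; split => //.
  by rewrite Hset_exponents; exists x.
rewrite fsbig_image; last by move=> x y _ _; apply: exponents_inj.
rewrite -(bigfs _ (r := index_enum _)) ?index_enum_uniq //; last first.
  by move=> x _; rewrite mem_index_enum.
(* Quadruples with pr(x) outside D receive the term 0, as unequal monomials pair to 0. *)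
rewrite [RHS]big_mkcond; apply: eq_bigr => x _.
rewrite big_split prod_symbol -!rmorph_prod /= mulrA -rmorphM /= apply_at0_monomial.
case: eqP => // balanced.
(* The factorials give Gamma(pr(x)+1); the coefficients of the four f_i give z^x / Gamma(x+1). *)
rewrite mulrC natr_prod -mulrA; congr (_ * _).
  rewrite (reindex (@enum_rank (Avar n))) /=; last exact/onW_bij/enum_rank_bij.
  by apply: eq_bigr => jX _; rewrite Dcoef_pr_exponents // GammaS.
rewrite -prodf_div.
rewrite prod_Zall.
apply: eq_bigr => i _.
rewrite mcoeff_prodform_Z //; last exact: ssvalP.
apply: eq_bigr => v _.
by rewrite ffunE GammaS.
Qed.

End Quadruple.
End Expansion.

Theorem theorem6 (F : fieldType) (F_char0 : [pchar F] =i pred0)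
    (n : nat) (n_gt0 : (0 < n)%N)
    (E : block n -> detexpr n F) (E_fixed : fixed_expressions E)
    (V1 V2 V3 U W H : hweight n) (f1 f2 f3 f4 : prodform n)
    (f1_type : has_type f1 V1 V2 U) (f2_type : has_type f2 U V3 W)
    (f3_type : has_type f3 V2 V3 H) (f4_type : has_type f4 V1 H W) :
  sixj E f1 f2 f3 f4
  = Jgamma (Znumber (E := E) (f := tnth [tuple f1; f2; f3; f4])).
Proof.
rewrite -apply_at0_product // /sixj; congr apply_at0.
(* At each concrete index, [symbol] computes to the argument displayed in [sixj]. *)
by rewrite !big_ord_recr big_ord0 /= mul1r.
Qed.
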